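(* Let $\underline{P}:\mathcal{D}_{LIN}\to\mathbb{R}$ be $2$-coherent. Define $$\mathcal{A}'=\{\lambda B(X-x)+Y: X|B\in\mathcal{D}_{LIN},\ x<\underline{P}(X|B),\ Y\in\mathcal{X}^{\succeq},\ \lambda\geq 0\}.$$ Then the set $\mathcal{A}'$ is such that: a') $a\mathcal{A}'+\mathcal{X}^{\succeq}\subseteq\mathcal{A}'$ for all $a\geq 0$; b') $\mathcal{X}^{\preceq}\cap\mathcal{A}'=\{0\}$; c') $(\mathcal{A}'+\mathcal{A}')\setminus\{0\}\subseteq\mathcal{X}\setminus\mathcal{X}^{\preceq}$; d') $\underline{P}(X|B)=\sup\{x\in\mathbb{R}:B(X-x)\in\mathcal{A}'\}$ for all $X|B\in\mathcal{D}_{LIN}$.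
   Context: Fix a partition $\mathbb{P}$ of the sure event $\Omega$ into atoms $\omega$. A gamble is a bounded function $X:\mathbb{P}\to\mathbb{R}$. Events are subsets of $\mathbb{P}$, identified with their indicators; $\vee$ denotes union. For a gamble $X$ and an event $B\neq\varnothing$, the conditional gamble $X|B$ is the restriction of $X$ to $B$; thus $\sup\{X|B\}=\sup_{\omega\in B}X(\omega)$. Let $\mathcal{X}$ be a linear space of gambles and $\mathcal{B}\subset\mathcal{X}$ a set of (indicators of) events, with $\Omega\in\mathcal{B}$ and $BX\in\mathcal{X}$ for all $B\in\mathcal{B}$, $X\in\mathcal{X}$. Put $\mathcal{B}^{\varnothing}=\mathcal{B}\setminus\{\varnothing\}$, $\mathcal{D}_{LIN}=\{X|B: X\in\mathcal{X}, B\in\mathcal{B}^{\varnothing}\}$, $\mathcal{X}^{\succeq}=\{X\in\mathcal{X}:\inf X\geq 0\}$, $\mathcal{X}^{\preceq}=\{X\in\mathcal{X}:\sup X\leq 0\}$. Sums of sets are Minkowski sums: $a\mathcal{S}+\mathcal{T}=\{aX+Y:X\in\mathcal{S},Y\in\mathcal{T}\}$. $\underline{P}:\mathcal{D}\to\mathbb{R}$ is $2$-coherent on $\mathcal{D}$ iff for all $X_0|B_0,X_1|B_1\in\mathcal{D}$, all $s_1\geq 0$ and all $s_0\in\mathbb{R}$, setting $S(\underline{s})=\bigvee\{B_i:s_i\neq 0,\ i=0,1\}$ and $\underline{G}_2=s_1B_1(X_1-\underline{P}(X_1|B_1))-s_0B_0(X_0-\underline{P}(X_0|B_0))$, one has $\sup\{\underline{G}_2|S(\underline{s})\}\geq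 0$ whenever $S(\underline{s})\neq\varnothing$. *)

(* Defs.v *)
From HB Require Import structures.
From mathcomp Require Import all_boot all_order all_algebra.
From mathcomp Require Import all_classical all_reals all_analysis.

Set Implicit Arguments.
Unset Strict Implicit.
Unset Printing Implicit Defensive.

Import Order.TTheory GRing.Theory Num.Theory.
Import numFieldNormedType.Exports.

Local Open Scope classical_set_scope.
Local Open Scope ring_scope.

(* The points of [Omega] are the atoms of the partition. *)

Definition gamble (R : realType) (Omega : Type) (X : Omega -> R) : Prop :=
  exists M : R, forall w, `|X w| <= M.

(* A conditional gamble X|B is the restriction of X to B, so that X|B and Y|C
   are the same object exactly when B = C and X, Y agree on B. *)
Definition cond_gamble (R : realType) (Omega : Type) : Type :=
  {B : set Omega & B -> R}.

Definition cond (R : realType) (Omega : Type) (X : Omega -> R)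
    (B : set Omega) : cond_gamble R Omega :=
  existT (fun C : set Omega => C -> R) B (sigL B X).

(* Extended-real bounds, so that no junk value is attached to sets that are
   empty or unbounded. *)
Definition gsup (R : realType) (Omega : Type) (X : Omega -> R)
    (B : set Omega) : \bar R := ereal_sup [set (X w)%:E | w in B].

Definition ginf (R : realType) (Omega : Type) (X : Omega -> R)
    (B : set Omega) : \bar R := ereal_inf [set (X w)%:E | w in B].

Definition linear_space (R : realType) (Omega : Type)
    (XX : set (Omega -> R)) : Prop :=
  XX 0 /\ forall (a : R) (X Y : Omega -> R), XX X -> XX Y -> XX (a *: X + Y).

Definition D_LIN (R : realType) (Omega : Type) (XX : set (Omega -> R))
    (BB : set (set Omega)) : set (cond_gamble R Omega) :=
  [set cond X B | X in XX & B in BB `\ set0].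

Definition nonneg_gambles (R : realType) (Omega : Type)
    (XX : set (Omega -> R)) : set (Omega -> R) :=
  [set X | XX X /\ (0 <= ginf X setT)%E].

Definition nonpos_gambles (R : realType) (Omega : Type)
    (XX : set (Omega -> R)) : set (Omega -> R) :=
  [set X | XX X /\ (gsup X setT <= 0)%E].

Definition minkowski_sum (R : realType) (Omega : Type) (a : R)
    (S T : set (Omega -> R)) : set (Omega -> R) :=
  [set a *: X + Y | X in S & Y in T].

(* The gamble B(X - x), which is 0 off B and hence depends on X only through
   X|B. *)
Definition bet (R : realType) (Omega : Type) (X : Omega -> R)
    (B : set Omega) (x : R) : Omega -> R :=
  \1_B \* (X - cst x).

(* [P] is total; only its values on [D] matter. *)
Definition two_coherent (R : realType) (Omega : Type)
    (D : set (cond_gamble R Omega)) (P : cond_gamble R Omega -> R) : Prop :=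
  forall (X0 X1 : Omega -> R) (B0 B1 : set Omega),
    D (cond X0 B0) -> D (cond X1 B1) ->
  forall s1 s0 : R, 0 <= s1 ->
    let S := [set w | s0 != 0 /\ B0 w] `|` [set w | s1 != 0 /\ B1 w] in
    let G := s1 *: bet X1 B1 (P (cond X1 B1))
             - s0 *: bet X0 B0 (P (cond X0 B0)) in
    S !=set0 -> (0 <= gsup G S)%E.

Definition A' (R : realType) (Omega : Type) (XX : set (Omega -> R))
    (BB : set (set Omega)) (P : cond_gamble R Omega -> R) :
    set (Omega -> R) :=
  [set Z | exists (lambda x : R) (X Y : Omega -> R) (B : set Omega),
    [/\ D_LIN XX BB (cond X B), x < P (cond X B), nonneg_gambles XX Y,
        0 <= lambda & Z = lambda *: bet X B x + Y]].

(* Main.v *)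
Require Import Defs.
From HB Require Import structures.
From mathcomp Require Import all_boot all_order all_algebra.
From mathcomp Require Import all_classical all_reals all_analysis.
From mathcomp Require Import ring lra.

Set Implicit Arguments.
Unset Strict Implicit.
Unset Printing Implicit Defensive.

Import Order.TTheory GRing.Theory Num.Theory.
Import numFieldNormedType.Exports.

Local Open Scope classical_set_scope.
Local Open Scope ring_scope.

(* All four claims rest on one consequence of 2-coherence: two bets, neither on
   worse terms than P and each active one strictly better, have a combined gain
   that is positive somewhere.  For buying both bets this makes a nonpositive
   sum of two elements of A' have zero multipliers, which gives b') (take one
   summand to be 0) and c').  For selling X|B at x > P(X|B) it shows that
   B(X - x) is not in A', which is the nontrivial half of d'). *)

Lemma gsup_le0P (R : realType) (Omega : Type) (X : Omega -> R) :
  (gsup X setT <= 0)%E <-> forall w, X w <= 0.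
Proof.
split=> [X_le0 w|X_le0].
  by rewrite -lee_fin; apply: le_trans X_le0; apply: ereal_sup_ubound; exists w.
by apply: ge_ereal_sup => _ [w _ <-]; rewrite lee_fin.
Qed.

Lemma ginf_ge0P (R : realType) (Omega : Type) (X : Omega -> R) :
  (0 <= ginf X setT)%E <-> forall w, 0 <= X w.
Proof.
split=> [X_ge0 w|X_ge0].
  rewrite -lee_fin; apply: le_trans X_ge0 _.
  by apply: ereal_inf_lbound; exists w.
by apply: le_ereal_inf_tmp => _ [w _ <-]; rewrite lee_fin.
Qed.

Lemma gsup_ge0_gt (R : realType) (Omega : Type) (X : Omega -> R)
    (S : set Omega) (e : R) :
  0 < e -> (0 <= gsup X S)%E -> exists2 w, S w & - e < X w.
Proof.
move=> e_gt0 X_ge0.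
have /ereal_sup_gt [_ [w Sw <-]] : ((- e)%:E < gsup X S)%E.
  by apply: lt_le_trans X_ge0; rewrite lte_fin oppr_lt0.
by rewrite lte_fin; exists w.
Qed.

Lemma betE (R : realType) (Omega : Type) (X : Omega -> R) (B : set Omega)
    (x : R) (w : Omega) : bet X B x w = \1_B w * (X w - x).
Proof. by []. Qed.

(** Membership in [D_LIN] only supplies some representative [Y|C] of [X|B]; this transfers what is
    known of [Y] and [C] to [X] and [B]. *)
Lemma cond_inj (R : realType) (Omega : Type) (X Y : Omega -> R)
    (B C : set Omega) :
  cond X B = cond Y C -> B = C /\ {in B, X =1 Y}.
Proof.
move=> e; have eBC : B = C := projT1_eq e.
subst C; split=> //; apply/eq_sigLP.
(* The second components agree up to transport along a proof of [B = B]; replacing that proof by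
   [erefl] makes the transport trivial. *)
by have := projT2_eq e; rewrite (Prop_irrelevance (projT1_eq e) erefl).
Qed.

Section LinearSpace.
Variables (R : realType) (Omega : Type) (XX : set (Omega -> R)).
Hypothesis XX_linear : linear_space XX.

Lemma linear_spaceD (X Y : Omega -> R) : XX X -> XX Y -> XX (X + Y).
Proof. by move=> XX_X XX_Y; rewrite -(scale1r X); apply: XX_linear.2. Qed.

Lemma nonneg_gambles0 : nonneg_gambles XX 0.
Proof. by split; [case: XX_linear | apply/ginf_ge0P]. Qed.

Lemma nonneg_gambles_lin (a : R) (X Y : Omega -> R) :
  0 <= a -> nonneg_gambles XX X -> nonneg_gambles XX Y ->
  nonneg_gambles XX (a *: X + Y).
Proof.
move=> a_ge0 [XX_X /ginf_ge0P X_ge0] [XX_Y /ginf_ge0P Y_ge0].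
split; first exact: XX_linear.2.
by apply/ginf_ge0P => w; apply: addr_ge0 => //; apply: mulr_ge0.
Qed.

Variable BB : set (set Omega).
Hypothesis BB_sub : forall B : set Omega, BB B -> XX \1_B.
Hypothesis BB_XX : forall (B : set Omega) (X : Omega -> R),
  BB B -> XX X -> XX (\1_B \* X).

Lemma D_LIN_nonempty (X : Omega -> R) (B : set Omega) :
  D_LIN XX BB (cond X B) -> B !=set0.
Proof.
by move=> [Y _ [C [_ /eqP/set0P C_neq0] /cond_inj[<- _]]].
Qed.

Lemma bet_in_space (X : Omega -> R) (B : set Omega) (x : R) :
  D_LIN XX BB (cond X B) -> XX (bet X B x).
Proof.
move=> [Y XX_Y [C [BB_C _] /cond_inj[eCB eXY]]]; subst C.
(* [X] is known to agree with a member of [XX] only on [B], but the bet vanishes off [B], so [Y] can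
   stand in for [X]. *)
have -> : bet X B x = - x *: \1_B + \1_B \* Y.
  apply/funext => w.
  have -> : (- x *: \1_B + \1_B \* Y) w = - x * \1_B w + \1_B w * Y w by [].
  rewrite betE indicE; have [Bw|_] := boolP (w \in B).
    by rewrite -(eXY _ Bw); ring.
  by rewrite !mul0r mulr0 addr0.
by apply: XX_linear.2; [exact: BB_sub | exact: BB_XX].
Qed.

End LinearSpace.

Section Coherence.
Variables (R : realType) (Omega : Type) (D : set (cond_gamble R Omega)).
Variable P : cond_gamble R Omega -> R.
Hypothesis P_coherent : two_coherent D P.

(* Moving each price strictly in the bettor's favour raises the gain by a
   uniform positive amount on the support of the combined bet, so its supremum,
   nonnegative at the prices [P], becomes positive. *)
Lemma two_coherent_gain (X0 X1 : Omega -> R) (B0 B1 : set Omega)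
    (x0 x1 s0 s1 : R) :
  D (cond X0 B0) -> D (cond X1 B1) -> 0 <= s1 ->
  (s1 != 0 -> x1 < P (cond X1 B1)) ->
  (s0 != 0 -> 0 < s0 * (x0 - P (cond X0 B0))) ->
  [set w | s0 != 0 /\ B0 w] `|` [set w | s1 != 0 /\ B1 w] !=set0 ->
  exists w, 0 < s1 * bet X1 B1 x1 w - s0 * bet X0 B0 x0 w.
Proof.
move=> D0 D1 s1_ge0 x1P x0P S_neq0.
set p0 := P (cond X0 B0) in x0P *; set p1 := P (cond X1 B1) in x1P *.
pose d1 := s1 * (p1 - x1); pose d0 := s0 * (x0 - p0).
have d1_gt0 : s1 != 0 -> 0 < d1.
  by move=> s1N0; rewrite mulr_gt0 ?subr_gt0 ?x1P// lt0r s1N0.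
have d1_ge0 : 0 <= d1.
  by have [s10|/d1_gt0/ltW//] := eqVneq s1 0; rewrite /d1 s10 mul0r.
have d0_ge0 : 0 <= d0.
  by have [s00|/x0P/ltW//] := eqVneq s0 0; rewrite /d0 s00 mul0r.
(* [d0] and [d1] are what the better prices add on [B0] and [B1]. The tolerance [e] must not exceed
   either active one; an inactive bet has increment 0, so 1 replaces it in the minimum. *)
have [e e_gt0 [le_e0 le_e1]] : exists2 e, 0 < e &
    (s0 != 0 -> e <= d0) /\ (s1 != 0 -> e <= d1).
  exists (Num.min (if s0 == 0 then 1 else d0) (if s1 == 0 then 1 else d1)).
    rewrite lt_min; apply/andP; split.
      by case: eqVneq => [_|/x0P].
    by case: eqVneq => [_|/d1_gt0].
  by split=> /negbTE ->; rewrite ge_min lexx ?orbT.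
have [w Sw] := gsup_ge0_gt e_gt0 (P_coherent D0 D1 s1_ge0 S_neq0).
rewrite -/p0 -/p1 => Gw; exists w.
have {}Gw : - e < s1 * bet X1 B1 p1 w - s0 * bet X0 B0 p0 w by exact: Gw.
have gainE : s1 * bet X1 B1 x1 w - s0 * bet X0 B0 x0 w =
    s1 * bet X1 B1 p1 w - s0 * bet X0 B0 p0 w
    + (\1_B0 w * d0 + \1_B1 w * d1).
  by rewrite !betE /d0 /d1; ring.
have e_le : e <= \1_B0 w * d0 + \1_B1 w * d1.
  (* The point [w] lies in the event of some active bet, whose increment alone reaches [e]; the
     other term is nonnegative. *)
  case: Sw => -[/[dup] sN0 + Bw].
    move=> /le_e0; rewrite [\1_B0 w]indicE mem_set// mul1r => /le_trans; apply.
    by rewrite lerDl mulr_ge0// indicE ler0n.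
  move=> /le_e1; rewrite [\1_B1 w]indicE mem_set// mul1r => /le_trans; apply.
  by rewrite lerDr mulr_ge0// indicE ler0n.
by rewrite gainE; lra.
Qed.

End Coherence.

Section ConeSum.
Variables (R : realType) (Omega : Type) (XX : set (Omega -> R)).
Variables (BB : set (set Omega)) (P : cond_gamble R Omega -> R).
Hypothesis XX_linear : linear_space XX.
Hypothesis P_coherent : two_coherent (D_LIN XX BB) P.

Lemma A'_sum_nonpos (Z0 Z1 : Omega -> R) :
  A' XX BB P Z0 -> A' XX BB P Z1 -> (forall w, (Z0 + Z1) w <= 0) ->
  Z0 + Z1 = 0.
Proof.
move=> [l0 [x0 [X0 [Y0 [B0 [D0 x0P [_ /ginf_ge0P Y0_ge0] l0_ge0 ->]]]]]].
move=> [l1 [x1 [X1 [Y1 [B1 [D1 x1P [_ /ginf_ge0P Y1_ge0] l1_ge0 ->]]]]]].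
move=> Z_le0.
(* The stake [s0] may have either sign: [s0 = - l0] turns the sale of the first bet into a purchase.
   A positive gain somewhere then contradicts [Z_le0]. *)
have [S_neq0|S0] := pselect
  ([set w | - l0 != 0 /\ B0 w] `|` [set w | l1 != 0 /\ B1 w] !=set0).
  have [|w] :=
    two_coherent_gain (x0 := x0) P_coherent D0 D1 l1_ge0 (fun=> x1P) _ S_neq0.
    rewrite oppr_eq0 => l0N0.
    by rewrite mulNr -mulrN opprB mulr_gt0 ?subr_gt0// lt0r l0N0.
  have Zw : l0 * bet X0 B0 x0 w + Y0 w + (l1 * bet X1 B1 x1 w + Y1 w) <= 0.
    exact: Z_le0.
  rewrite mulNr opprK addrC => gain_gt0.
  have := ltr_wpDr (addr_ge0 (Y0_ge0 w) (Y1_ge0 w)) gain_gt0.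
  by rewrite addrACA => /lt_le_trans/(_ Zw); rewrite ltxx.
(* Conditioning events are nonempty, so an empty support forces both multipliers to vanish, leaving
   only [Y0 + Y1]. *)
have l00 : l0 = 0.
  apply: contra_notP S0 => /eqP l0N0.
  by have [w Bw] := D_LIN_nonempty D0; exists w; left; rewrite /= oppr_eq0.
have l10 : l1 = 0.
  apply: contra_notP S0 => /eqP l1N0.
  by have [w Bw] := D_LIN_nonempty D1; exists w; right.
move: Z_le0; rewrite l00 l10 !scale0r !add0r => Z_le0.
by apply/funext => w; apply/eqP; rewrite eq_le Z_le0 addr_ge0.
Qed.

Lemma bet_in_A' (X : Omega -> R) (B : set Omega) (x : R) :
  D_LIN XX BB (cond X B) -> x < P (cond X B) -> A' XX BB P (bet X B x).
Proof.
move=> DXB xP; exists 1, x, X, 0, B; split=> //.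
  exact: nonneg_gambles0.
by rewrite scale1r addr0.
Qed.

Lemma bet_in_A'_le (X : Omega -> R) (B : set Omega) (x : R) :
  D_LIN XX BB (cond X B) -> A' XX BB P (bet X B x) -> x <= P (cond X B).
Proof.
move=> DXB [l [x1 [X1 [Y [B1 [D1 x1P [_ /ginf_ge0P Y_ge0] l_ge0 betXE]]]]]].
rewrite leNgt; apply/negP => Px.
(* Sell [X|B] at [x] and buy the bet from its representation in [A']: the gain is [- Y], nowhere
   positive. The unit stake keeps the support nonempty even if [l = 0]. *)
have [||w] := two_coherent_gain (x0 := x) (s0 := 1) P_coherent DXB D1 l_ge0
  (fun=> x1P).
- by rewrite mul1r subr_gt0.
- by have [w Bw] := D_LIN_nonempty DXB; exists w; left; rewrite /= oner_eq0.
have -> : bet X B x w = l * bet X1 B1 x1 w + Y w by rewrite betXE.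
by rewrite mul1r opprD addNKr oppr_gt0 ltNge Y_ge0.
Qed.

End ConeSum.

Theorem proposition18 (R : realType) (Omega : Type)
    (Omega_neq0 : [set: Omega] !=set0)
    (XX : set (Omega -> R)) (BB : set (set Omega))
    (XX_gambles : forall X : Omega -> R, XX X -> gamble X)
    (XX_linear : linear_space XX)
    (BB_sub : forall B : set Omega, BB B -> XX \1_B)
    (BB_Omega : BB [set: Omega])
    (BB_XX : forall (B : set Omega) (X : Omega -> R),
       BB B -> XX X -> XX (\1_B \* X))
    (P : cond_gamble R Omega -> R)
    (P_coherent : two_coherent (D_LIN XX BB) P) :
  [/\ forall a : R, 0 <= a ->
        minkowski_sum a (A' XX BB P) (nonneg_gambles XX) `<=` A' XX BB P,
      nonpos_gambles XX `&` A' XX BB P = [set 0],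
      minkowski_sum 1 (A' XX BB P) (A' XX BB P) `\` [set 0]
        `<=` XX `\` nonpos_gambles XX
    & forall (X : Omega -> R) (B : set Omega), D_LIN XX BB (cond X B) ->
        (P (cond X B))%:E =
        ereal_sup [set x%:E | x in [set x : R | A' XX BB P (bet X B x)]]].
Proof.
have A'_space Z : A' XX BB P Z -> XX Z.
  move=> [l [x [X [Y [B [DXB _ [XX_Y _] _ ->]]]]]].
  by apply: XX_linear.2 => //; exact: (bet_in_space XX_linear BB_sub BB_XX).
have A'0 : A' XX BB P 0.
  (* Even with multiplier 0 a conditional gamble and an admissible price must be named: [0] given
     the sure event, priced 1 below [P]. *)
  exists 0, (P (cond (0 : Omega -> R) setT) - 1), 0, 0, setT; split=> //.
  - exists 0; first by case: XX_linear.
    by exists setT => //; split=> //; apply/eqP/set0P.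
  - by rewrite ltrBlDr ltrDl.
  - exact: nonneg_gambles0.
  - by rewrite scale0r addr0.
split.
- move=> a a_ge0 _ [_ [l [x [X [Y [B [DXB xP Y_nneg l_ge0 ->]]]]]] [Y' Y'_nneg <-]].
  exists (a * l), x, X, (a *: Y + Y'), B; split=> //.
  + exact: nonneg_gambles_lin.
  + exact: mulr_ge0.
  + by rewrite scalerDr scalerA addrA.
- apply/seteqP; split=> [Z [[_ /gsup_le0P Z_le0] A'Z] /=|_ ->].
    by have := A'_sum_nonpos P_coherent A'Z A'0; rewrite addr0; exact.
  by split=> //; split; [case: XX_linear | apply/gsup_le0P].
- move=> _ [[Z0 A'Z0 [Z1 A'Z1 <-]]]; rewrite scale1r => Z_neq0; split.
    by apply: (linear_spaceD XX_linear); exact: A'_space.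
  move=> [_ /gsup_le0P Z_le0]; apply: Z_neq0.
  exact: (A'_sum_nonpos P_coherent).
- move=> X B DXB; apply/eqP; rewrite eq_le; apply/andP; split.
    (* Prices in [A'] are strictly below [P], so the supremum is approached through
       [P (cond X B) - e]. *)
    apply/lee_addgt0Pr => e e_gt0; rewrite -leeBlDr// -EFinB.
    apply: ereal_sup_ubound; exists (P (cond X B) - e) => //=.
    by apply: bet_in_A' => //; rewrite ltrBlDr ltrDl.
  apply: ge_ereal_sup => _ [x A'x <-].
  by rewrite lee_fin; exact: (bet_in_A'_le P_coherent).
Qed.
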